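(* The following two complementarization axioms are admissible in the dGLsc proof calculus (adding them as axioms does not change the set of derivable formulas), for all hybrid games $\alpha$ and formulas $P,Q$: (1) $\langle\alpha\rangle(P,Q)\leftrightarrow\langle\alpha^{-d}\rangle(P\wedge Q)\vee\langle\alpha\rangle P$; (2) $[\alpha](P,Q)\leftrightarrow\langle\alpha^{-d}\rangle(P\wedge Q)\vee[\alpha]Q$.
   Context: Semi-competitive differential game logic (dGLsc). Hybrid games: $\alpha,\beta::= x:=e \mid x'=f(x)\,\&\,Q \mid ?Q \mid \alpha\cup\beta \mid \alpha;\beta \mid \alpha^d \mid \alpha^*$. Formulas: $P,Q::= e\ge\tilde e\mid\neg P\mid P\wedge Q\mid\forall x P\mid\exists xP\mid\langle\alpha\rangle(P,Q)\mid[\alpha](P,Q)$ (in $\langle\alpha\rangle(P,Q)$ Angel has goal $P$ and Demon goal $Q$, and Angel is to win; in $[\alpha](P,Q)$ Demon is to win). Abbreviations: $\langle\alpha\rangle P:=\langle\alpha\rangle(P,\neg P)$ and $[\alpha]Q:=[\alpha](\neg Q,Q)$. The systematization $\alpha^{-d}$ removes all duals: $(x:=e)^{-d}=x:=e$, $(x'=f(x)\&Q)^{-d}=x'=f(x)\&Q$, $(?Q)^{-d}=?Q$, $(\alpha\cup\beta)^{-d}=\alpha^{-d}\cup\beta^{-d}$, $(\alpha;\beta)^{-d}=\alpha^{-d};\beta^{-d}$, $(\alpha^d)^{-d}=\alpha^{-d}$, $(\alpha^* )^{-d}=(\alpha^{-d})^*$. The dGLsc proof calculus consists of all proof rules of first-order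 logic together with the following axioms and rules (in $\langle'\rangle,[']$, $y(t)$ resp. $x(t)$ denotes the solution at time $t$ of $y'=f(y)$ resp. $x'=f(x)$ from the current value of $x$): $\langle:=\rangle$: $\langle x:=e\rangle(p(x),q(x))\leftrightarrow p(e)$; $[:=]$: $[x:=e](p(x),q(x))\leftrightarrow q(e)$; $\langle'\rangle$: $\langle x'=f(x)\rangle(P,Q)\leftrightarrow\exists t{\ge}0\,\langle x:=y(t)\rangle(P,Q)$; $[']$: $[x'=f(x)](P,Q)\leftrightarrow\forall t{\ge}0\,[x:=x(t)](P,Q)\vee\exists t{\ge}0\,\langle x:=x(t)\rangle(P\wedge Q,Q)$; $\langle?\rangle$: $\langle ?R\rangle(P,Q)\leftrightarrow R\wedge P$; $[?]$: $[?R](P,Q)\leftrightarrow\neg R\vee Q$; $\langle\cup\rangle$: $\langle\alpha\cup\beta\rangle(P,Q)\leftrightarrow\langle\alpha\rangle(P,Q)\vee\langle\beta\rangle(P,Q)$; $[\cup]$: $[\alpha\cup\beta](P,Q)\leftrightarrow([\alpha](P,Q)\wedge[\beta](P,Q))\vee([\alpha](P,Q)\wedge\langle\alpha\rangle(P,Q))\vee([\beta](P,Q)\wedge\langle\beta\rangle(P,Q))$; $\langle;\rangle$: $\langle\alpha;\beta\rangle(P,Q)\leftrightarrow\langle\alpha\rangle(\langle\beta\rangle(P,Q),[\beta](P,Q))$; $[;]$: $[\alpha;\beta](P,Q)\leftrightarrow[\alpha](\langle\beta\rangle(P,Q),[\beta](P,Q))$; $\langle^d\rangle$: $\langle\alpha^d\rangle(P,Q)\leftrightarrow[\alpha](Q,P)$;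 $\langle^*\rangle$: $\langle\alpha^*\rangle(P,Q)\leftrightarrow P\vee\langle\alpha;\alpha^*\rangle(P,Q)$; $[^*]$: $[\alpha^*](P,Q)\leftrightarrow(P\wedge Q)\vee(\langle\alpha;\alpha^*\rangle(P,Q)\wedge[\alpha;\alpha^*](P,Q))\vee(Q\wedge[\alpha;\alpha^*]Q)$; FP: from $P\vee\langle\alpha\rangle R_1\to R_1$ and $(P\wedge Q)\vee(\langle\alpha\rangle(R_2,R_2)\wedge[\alpha](R_2,R_2))\to R_2$ infer $\langle\alpha^*\rangle(P,Q)\to R_1\vee R_2$; M: from $P_1\to P_2$ and $Q_1\to Q_2$ infer $\langle\alpha\rangle(P_1,Q_1)\to\langle\alpha\rangle(P_2,Q_2)$; M2: from $P_1\to P_2$ and $P_1\wedge Q_1\to\bot$ infer $\langle\alpha\rangle(P_1,Q_1)\to\langle\alpha\rangle(P_2,Q_2)$; det: $\neg\langle\alpha\rangle P\leftrightarrow[\alpha]\neg P$.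
   Formalization: The claim fails for the calculus exactly as listed; the theorem adds the missing rules: [α^d](P,Q)↔⟨α⟩(Q,P), versions of ⟨'⟩ and ['] for x'=f(x)&Q with an evolution domain, and a box companion of FP: from FP's second premise infer [α*](P,Q)→[α*]Q∨R2. *)

(* Defs.v *)
(* Uses the Stdlib world: naturals, lists and the classical reals. *)
From Stdlib Require Export Reals QArith Qreals List Arith Bool ClassicalEpsilon.
Export ListNotations.
Local Open Scope nat_scope.
Local Open Scope list_scope.
Local Open Scope bool_scope.

(** * Syntax *)

Definition var := nat.

(* [TFlow o a x t] is the value of [x] at time [t] on the solution of the ODE
   system [o] that starts in the state [a].  All variables of [o] are bound by
   [a], so [o] acts as the name of a function symbol with arguments [a], [t]. *)
Inductive term : Type :=
| TVar (x : var)
| TConst (c : Q)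
| TAdd (e1 e2 : term)
| TMul (e1 e2 : term)
| TFlow (o : list (var * term)) (a : list (var * term)) (x : var) (t : term).

(* A vector of variables paired with a vector of terms; in case of repeated
   variables the first binding counts. *)
Definition bindings := list (var * term).

(* In [x := e] and [x' = f(x)] the variable [x] may be a vector; assignment is
   simultaneous. *)
Inductive formula : Type :=
| FGe (e1 e2 : term)
| FNot (P : formula)
| FAnd (P Q : formula)
| FAll (x : var) (P : formula)
| FEx (x : var) (P : formula)
| FDia (a : game) (P Q : formula)
| FBox (a : game) (P Q : formula)
with game : Type :=
| GAssign (s : bindings)
| GOde (o : bindings) (R : formula)
| GTest (R : formula)
| GChoice (a b : game)
| GSeq (a b : game)
| GDual (a : game)
| GStar (a : game).

Definition FOr P Q := FNot (FAnd (FNot P) (FNot Q)).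
Definition FImp P Q := FNot (FAnd P (FNot Q)).
Definition FIff P Q := FAnd (FImp P Q) (FImp Q P).
Definition TZero := TConst 0.
Definition FFalse := FAnd (FGe TZero TZero) (FNot (FGe TZero TZero)).
Definition FTrue := FNot FFalse.

Definition dia (a : game) (P : formula) := FDia a P (FNot P).
Definition box (a : game) (Q : formula) := FBox a (FNot Q) Q.

Definition ode (o : bindings) : game := GOde o FTrue.

Fixpoint systematize (a : game) : game :=
  match a with
  | GAssign s => GAssign s
  | GOde o R => GOde o R
  | GTest R => GTest R
  | GChoice a b => GChoice (systematize a) (systematize b)
  | GSeq a b => GSeq (systematize a) (systematize b)
  | GDual a => systematize a
  | GStar a => GStar (systematize a)
  end.

(** * Free and bound variables *)

Definition memb (x : var) (l : list var) : bool := existsb (Nat.eqb x) l.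
Definition minus (l m : list var) : list var :=
  filter (fun x => negb (memb x m)) l.
Definition disjointb (l m : list var) : bool :=
  forallb (fun x => negb (memb x m)) l.

Fixpoint tvars (e : term) : list var :=
  match e with
  | TVar x => [x]
  | TConst _ => []
  | TAdd e1 e2 | TMul e1 e2 => tvars e1 ++ tvars e2
  | TFlow _ a _ t => flat_map (fun '(_, e) => tvars e) a ++ tvars t
  end.

Definition dom (s : bindings) : list var := map fst s.
Definition rhs_vars (s : bindings) : list var :=
  flat_map (fun '(_, e) => tvars e) s.
Definition ode_vars (o : bindings) : list var := dom o ++ rhs_vars o.

Fixpoint bound_vars (a : game) : list var :=
  match a with
  | GAssign s => dom s
  | GOde o _ => dom o
  | GTest _ => []
  | GChoice a b | GSeq a b => bound_vars a ++ bound_vars b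
  | GDual a | GStar a => bound_vars a
  end.

(* The variables written on every path through the game. *)
Fixpoint must_bound_vars (a : game) : list var :=
  match a with
  | GAssign s => dom s
  | GOde o _ => dom o
  | GTest _ => []
  | GChoice a b =>
      filter (fun x => memb x (must_bound_vars b)) (must_bound_vars a)
  | GSeq a b => must_bound_vars a ++ must_bound_vars b
  | GDual a => must_bound_vars a
  | GStar _ => []
  end.

Fixpoint free_vars (F : formula) : list var :=
  match F with
  | FGe e1 e2 => tvars e1 ++ tvars e2
  | FNot P => free_vars P
  | FAnd P Q => free_vars P ++ free_vars Q
  | FAll x P | FEx x P => minus (free_vars P) [x]
  | FDia a P Q | FBox a P Q =>
      game_free_vars a ++
      minus (free_vars P ++ free_vars Q) (must_bound_vars a)
  end
with game_free_vars (a : game) : list var :=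
  match a with
  | GAssign s => rhs_vars s
  | GOde o R => ode_vars o ++ free_vars R
  | GTest R => free_vars R
  | GChoice a b => game_free_vars a ++ game_free_vars b
  | GSeq a b =>
      game_free_vars a ++ minus (game_free_vars b) (must_bound_vars a)
  | GDual a | GStar a => game_free_vars a
  end.

(** * Substitution *)

Fixpoint lookup (s : bindings) (x : var) : option term :=
  match s with
  | [] => None
  | (y, e) :: s' => if Nat.eqb x y then Some e else lookup s' x
  end.

Fixpoint tsubst (s : bindings) (e : term) : term :=
  match e with
  | TVar x => match lookup s x with Some e' => e' | None => TVar x end
  | TConst c => TConst c
  | TAdd e1 e2 => TAdd (tsubst s e1) (tsubst s e2)
  | TMul e1 e2 => TMul (tsubst s e1) (tsubst s e2)
  | TFlow o a x t =>
      TFlow o (map (fun '(y, e') => (y, tsubst s e')) a) x (tsubst s t)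
  end.

Definition bsubst (s r : bindings) : bindings :=
  map (fun '(y, e) => (y, tsubst s e)) r.

Definition restrict (s : bindings) (l : list var) : bindings :=
  filter (fun '(x, _) => memb x l) s.

(* Every formula [P] is of the form [p(x)], also when [x] is both read and
   written in [P], as in [<(x := x+1)*>(..)].  There the textual replacement
   of [x] is impossible, and a subformula [F] into which the substitution
   cannot be pushed without a clash of bound variables becomes the assignment
   [<x := e>(F, ~F)].  This makes [p(e)] total. *)
Fixpoint subst (s : bindings) (F : formula) : formula :=
  let s' := restrict s (free_vars F) in
  let suspended := dia (GAssign s') F in
  match F with
  | FGe e1 e2 => FGe (tsubst s e1) (tsubst s e2)
  | FNot P => FNot (subst s P)
  | FAnd P Q => FAnd (subst s P) (subst s Q)
  | FAll x P =>
      if memb x (rhs_vars s') then suspended else FAll x (subst s' P)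
  | FEx x P =>
      if memb x (rhs_vars s') then suspended else FEx x (subst s' P)
  | FDia a P Q =>
      if disjointb (bound_vars a) (dom s' ++ rhs_vars s')
      then FDia (game_subst s' a) (subst s' P) (subst s' Q) else suspended
  | FBox a P Q =>
      if disjointb (bound_vars a) (dom s' ++ rhs_vars s')
      then FBox (game_subst s' a) (subst s' P) (subst s' Q) else suspended
  end
with game_subst (s : bindings) (a : game) : game :=
  match a with
  | GAssign r => GAssign (bsubst s r)
  | GOde o R => GOde (bsubst s o) (subst s R)
  | GTest R => GTest (subst s R)
  | GChoice a b => GChoice (game_subst s a) (game_subst s b)
  | GSeq a b => GSeq (game_subst s a) (game_subst s b)
  | GDual a => GDual (game_subst s a)
  | GStar a => GStar (game_subst s a)
  end.

(** * Solutions of differential equations *)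

Definition state := var -> R.

(* [Y] solves [x' = F(x)] on the time interval [0, T] from [w]. *)
Definition solves (F : state -> state) (w : state) (T : R) (Y : R -> state) :=
  (forall x, Y 0%R x = w x) /\
  (forall r, (0 <= r <= T)%R ->
     forall x, derivable_pt_lim (fun r' => Y r' x) r (F (Y r) x)).

(* Unspecified where no solution exists. *)
Definition flow (F : state -> state) (w : state) (T : R) : state :=
  epsilon (inhabits (fun (_ : R) => w)) (solves F w T) T.

Fixpoint teval (e : term) (v : state) {struct e} : R :=
  match e with
  | TVar x => v x
  | TConst c => Q2R c
  | TAdd e1 e2 => (teval e1 v + teval e2 v)%R
  | TMul e1 e2 => (teval e1 v * teval e2 v)%R
  | TFlow o a x t =>
      let assign := fix assign (s : list (var * term)) (u : state) (y : var) :=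
        match s with
        | [] => 0%R
        | (z, f) :: s' => if Nat.eqb y z then teval f u else assign s' u y
        end in
      flow (assign o) (assign a v) (teval t v) x
  end.

(* The solution at time [t], from the current values, of the system [o]. *)
Definition solution (o : bindings) (t : var) : bindings :=
  map (fun x => (x, TFlow o (map (fun y => (y, TVar y)) (ode_vars o)) x (TVar t)))
      (dom o).

(* [y] is a vector of terms denoting the solution of [o] at time [t]. *)
Definition is_solution (o : bindings) (t : var) (y : bindings) : Prop :=
  ~ In t (ode_vars o) /\
  Forall2 (fun p q => fst p = fst q /\
             forall v : state, (0 <= v t)%R ->
               teval (snd p) v = teval (snd q) v)
    y (solution o t).

(** * Proof calculus *)

(* Truth value when every formula that is not a negation or conjunction is
   treated as propositional atom. *)
Fixpoint prop_eval (v : formula -> bool) (F : formula) : bool :=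
  match F with
  | FNot P => negb (prop_eval v P)
  | FAnd P Q => prop_eval v P && prop_eval v Q
  | _ => v F
  end.

Definition tautology (F : formula) : Prop :=
  forall v, prop_eval v F = true.

Definition all_ge0 (t : var) (P : formula) :=
  FAll t (FImp (FGe (TVar t) TZero) P).
Definition ex_ge0 (t : var) (P : formula) :=
  FEx t (FAnd (FGe (TVar t) TZero) P).

Definition fresh (x : var) (Fs : list formula) : Prop :=
  Forall (fun F => ~ In x (free_vars F)) Fs.

Inductive fol_axiom : formula -> Prop :=
| ax_taut F : tautology F -> fol_axiom F
| ax_all_inst x e P : fol_axiom (FImp (FAll x P) (subst [(x, e)] P))
| ax_all_dist x P Q :
    fol_axiom (FImp (FAll x (FImp P Q)) (FImp (FAll x P) (FAll x Q)))
| ax_all_vac x P : fresh x [P] -> fol_axiom (FImp P (FAll x P))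
| ax_ex x P : fol_axiom (FIff (FEx x P) (FNot (FAll x (FNot P)))).

Inductive game_axiom : formula -> Prop :=
| ax_dia_assign s P Q :
    game_axiom (FIff (FDia (GAssign s) P Q) (subst s P))
| ax_box_assign s P Q :
    game_axiom (FIff (FBox (GAssign s) P Q) (subst s Q))
| ax_dia_ode o t y P Q :
    is_solution o t y -> fresh t [P; Q] ->
    game_axiom (FIff (FDia (ode o) P Q) (ex_ge0 t (FDia (GAssign y) P Q)))
| ax_box_ode o t y P Q :
    is_solution o t y -> fresh t [P; Q] ->
    game_axiom (FIff (FBox (ode o) P Q)
      (FOr (all_ge0 t (FBox (GAssign y) P Q))
           (ex_ge0 t (FDia (GAssign y) (FAnd P Q) Q))))
| ax_dia_test R P Q :
    game_axiom (FIff (FDia (GTest R) P Q) (FAnd R P))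
| ax_box_test R P Q :
    game_axiom (FIff (FBox (GTest R) P Q) (FOr (FNot R) Q))
| ax_dia_choice a b P Q :
    game_axiom (FIff (FDia (GChoice a b) P Q) (FOr (FDia a P Q) (FDia b P Q)))
| ax_box_choice a b P Q :
    game_axiom (FIff (FBox (GChoice a b) P Q)
      (FOr (FOr (FAnd (FBox a P Q) (FBox b P Q))
                (FAnd (FBox a P Q) (FDia a P Q)))
           (FAnd (FBox b P Q) (FDia b P Q))))
| ax_dia_seq a b P Q :
    game_axiom (FIff (FDia (GSeq a b) P Q) (FDia a (FDia b P Q) (FBox b P Q)))
| ax_box_seq a b P Q :
    game_axiom (FIff (FBox (GSeq a b) P Q) (FBox a (FDia b P Q) (FBox b P Q)))
| ax_dia_dual a P Q :
    game_axiom (FIff (FDia (GDual a) P Q) (FBox a Q P))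
| ax_dia_star a P Q :
    game_axiom (FIff (FDia (GStar a) P Q)
      (FOr P (FDia (GSeq a (GStar a)) P Q)))
| ax_box_star a P Q :
    game_axiom (FIff (FBox (GStar a) P Q)
      (FOr (FOr (FAnd P Q)
                (FAnd (FDia (GSeq a (GStar a)) P Q)
                      (FBox (GSeq a (GStar a)) P Q)))
           (FAnd Q (box (GSeq a (GStar a)) Q))))
| ax_det a P :
    game_axiom (FIff (FNot (dia a P)) (box a (FNot P))).

(* A rule set relates lists of premises to conclusions. *)
Definition rules := list formula -> formula -> Prop.

(* The calculus extended with the rules [X]. *)
Inductive derivable (X : rules) : formula -> Prop :=
| d_fol F : fol_axiom F -> derivable X F
| d_game F : game_axiom F -> derivable X F
| d_mp P Q : derivable X (FImp P Q) -> derivable X P -> derivable X Q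
| d_gen x P : derivable X P -> derivable X (FAll x P)
| d_FP a P Q R1 R2 :
    derivable X (FImp (FOr P (dia a R1)) R1) ->
    derivable X
      (FImp (FOr (FAnd P Q) (FAnd (FDia a R2 R2) (FBox a R2 R2))) R2) ->
    derivable X (FImp (FDia (GStar a) P Q) (FOr R1 R2))
| d_M a P1 P2 Q1 Q2 :
    derivable X (FImp P1 P2) -> derivable X (FImp Q1 Q2) ->
    derivable X (FImp (FDia a P1 Q1) (FDia a P2 Q2))
| d_M2 a P1 P2 Q1 Q2 :
    derivable X (FImp P1 P2) -> derivable X (FImp (FAnd P1 Q1) FFalse) ->
    derivable X (FImp (FDia a P1 Q1) (FDia a P2 Q2))
| d_ext Fs F :
    X Fs F -> (forall G, In G Fs -> derivable X G) -> derivable X F.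

(* The flow stays in [R] up to time [t]; [y] is the solution at time [s]. *)
Definition stays_in (R : formula) (s t : var) (y : bindings) : formula :=
  FAll s (FImp (FAnd (FGe (TVar s) TZero) (FGe (TVar t) (TVar s)))
               (dia (GAssign y) R)).

(* [game_axiom] and the rules of [derivable] do not determine [[a^d](P, Q)] for
   overlapping [P] and [Q], do not treat ODEs with a proper evolution domain,
   and give no upper bound on [[a^*](P, Q)], as FP concerns [<a^*>] only.  The
   rules below are the missing companions of [<^d>], of [<'>] and ['], and of
   FP.  Complementarization is not derivable without them.  For example, the
   other rules remain sound when [[a](P, Q)] with
   [a = (x := x U (?false)^d)^*] is read as [exists x (P /\ Q)] and all other
   operators as usual; but for [P] and [Q] both [x >= 1],
   [<a^-d>(P /\ Q) \/ [a]Q] is equivalent to [x >= 1]. *)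
Inductive companion : rules :=
| ax_box_dual a P Q :
    companion [] (FIff (FBox (GDual a) P Q) (FDia a Q P))
| ax_dia_ode_domain o R s t ys yt P Q :
    is_solution o s ys -> is_solution o t yt -> s <> t ->
    fresh s [R] -> fresh t [R; P; Q] ->
    companion [] (FIff (FDia (GOde o R) P Q)
      (ex_ge0 t (FAnd (stays_in R s t ys) (FDia (GAssign yt) P Q))))
| ax_box_ode_domain o R s t ys yt P Q :
    is_solution o s ys -> is_solution o t yt -> s <> t ->
    fresh s [R] -> fresh t [R; P; Q] ->
    companion [] (FIff (FBox (GOde o R) P Q)
      (FOr (all_ge0 t (FImp (stays_in R s t ys) (FBox (GAssign yt) P Q)))
           (ex_ge0 t (FAnd (stays_in R s t ys)
                           (FDia (GAssign yt) (FAnd P Q) Q)))))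
| ru_FP_box a P Q R2 :
    companion
      [FImp (FOr (FAnd P Q) (FAnd (FDia a R2 R2) (FBox a R2 R2))) R2]
      (FImp (FBox (GStar a) P Q) (FOr (box (GStar a) Q) R2)).

Inductive complementarization : rules :=
| ax_dia_compl a P Q :
    complementarization [] (FIff (FDia a P Q)
      (FOr (dia (systematize a) (FAnd P Q)) (dia a P)))
| ax_box_compl a P Q :
    complementarization [] (FIff (FBox a P Q)
      (FOr (dia (systematize a) (FAnd P Q)) (box a Q))).

Definition adjoin (X Y : rules) : rules := fun Fs F => X Fs F \/ Y Fs F.

(* Main.v *)
(* Everything rests on the interaction principle
     <a>P /\ [a]Q -> <a^-d>(P /\ Q):
   let Angel and Demon both play their winning strategies; the resulting play
   is one that the single player of a^-d can choose.  Together with det it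
   splits disjunctive goals, <a>(P \/ Q) -> <a^-d>P \/ <a>Q, and likewise for
   [a].  Complementarization then follows by induction on the game.  For loops,
   FP and its box companion are applied to R2 = <(a^-d)^*>(P /\ Q); conversely,
   <a^*>(P,Q) /\ [a^*](P,Q) is an invariant of (a^-d)^*. *)
Require Import Defs.
From Stdlib Require Import Lia.

(* Closes a goal that follows propositionally from the derivations in context. *)
Ltac prop_derive :=
  repeat match goal with
  | H : derivable ?X ?G |- derivable ?X ?F =>
      refine (d_mp X G F _ H); clear H
  end;
  apply d_fol, ax_taut; let v := fresh in intro v;
  unfold all_ge0, ex_ge0, dia, box, FIff, FOr, FImp, FTrue, FFalse;
  cbn [prop_eval systematize];
  repeat match goal with
  | |- context [prop_eval v ?F] => generalize (prop_eval v F); intro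
  | |- context [v ?F] => generalize (v F); intro
  end;
  clear;
  repeat match goal with
  | b : bool |- _ => destruct b; cbn; try reflexivity
  end.

Ltac note_game X ax := let H := fresh in pose proof (d_game X _ ax) as H.
Ltac note_fol X ax := let H := fresh in pose proof (d_fol X _ ax) as H.

Lemma d_ax X F : X [] F -> derivable X F.
Proof. intro H; apply (d_ext X [] F H); intros G []. Qed.

(** * First-order logic *)

Lemma d_all_mono X x P Q :
  derivable X (FImp P Q) -> derivable X (FImp (FAll x P) (FAll x Q)).
Proof.
  intro H.
  apply (d_mp X _ _ (d_fol X _ (ax_all_dist x P Q))), d_gen, H.
Qed.

(** [ax_ex] reduces [FEx] to a negated [FAll], so the guarded implication is contraposed before the
    universal quantifier is distributed over it. *)
Lemma d_all_ex_mono X x G P Q :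
  derivable X (FImp G (FImp P Q)) ->
  derivable X (FImp (FAll x G) (FImp (FEx x P) (FEx x Q))).
Proof.
  intro H.
  assert (derivable X (FImp G (FImp (FNot Q) (FNot P)))) as H1 by prop_derive.
  clear H; apply (d_all_mono X x) in H1.
  note_fol X (ax_all_dist x (FNot Q) (FNot P)).
  note_fol X (ax_ex x P). note_fol X (ax_ex x Q).
  prop_derive.
Qed.

Lemma d_ex_mono X x P Q :
  derivable X (FImp P Q) -> derivable X (FImp (FEx x P) (FEx x Q)).
Proof.
  intro H.
  assert (derivable X (FImp (FNot Q) (FNot P))) as H1 by prop_derive.
  clear H; apply (d_all_mono X x) in H1.
  note_fol X (ax_ex x P). note_fol X (ax_ex x Q).
  prop_derive.
Qed.

Lemma d_ex_absurd X x P :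
  derivable X (FNot P) -> derivable X (FNot (FEx x P)).
Proof.
  intro H; apply (d_gen X x) in H.
  note_fol X (ax_ex x P).
  prop_derive.
Qed.

Lemma d_iff X P Q :
  derivable X (FImp P Q) -> derivable X (FImp Q P) -> derivable X (FIff P Q).
Proof. intros; prop_derive. Qed.

Lemma d_iff_l X P Q : derivable X (FIff P Q) -> derivable X (FImp P Q).
Proof. intros; prop_derive. Qed.

Lemma d_iff_r X P Q : derivable X (FIff P Q) -> derivable X (FImp Q P).
Proof. intros; prop_derive. Qed.

Lemma d_all_congr X x P Q :
  derivable X (FIff P Q) -> derivable X (FIff (FAll x P) (FAll x Q)).
Proof.
  intro H; apply d_iff; apply d_all_mono;
    [apply d_iff_l | apply d_iff_r]; exact H.
Qed.

Lemma d_ex_congr X x P Q :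
  derivable X (FIff P Q) -> derivable X (FIff (FEx x P) (FEx x Q)).
Proof.
  intro H; apply d_iff; apply d_ex_mono;
    [apply d_iff_l | apply d_iff_r]; exact H.
Qed.

(** * Monotonicity and determinacy *)

(** M and M2 speak of diamonds only; [ax_dia_dual], read backwards, turns a box over [a] into a
    diamond over [GDual a] with the goals swapped. *)
Lemma d_box_M X a P1 P2 Q1 Q2 :
  derivable X (FImp P1 P2) -> derivable X (FImp Q1 Q2) ->
  derivable X (FImp (FBox a P1 Q1) (FBox a P2 Q2)).
Proof.
  intros HP HQ.
  pose proof (d_M X (GDual a) _ _ _ _ HQ HP); clear HP HQ.
  note_game X (ax_dia_dual a Q1 P1). note_game X (ax_dia_dual a Q2 P2).
  prop_derive.
Qed.

Lemma d_box_M2 X a P1 P2 Q1 Q2 :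
  derivable X (FImp Q1 Q2) -> derivable X (FImp (FAnd Q1 P1) FFalse) ->
  derivable X (FImp (FBox a P1 Q1) (FBox a P2 Q2)).
Proof.
  intros HQ HP.
  pose proof (d_M2 X (GDual a) Q1 Q2 P1 P2 HQ HP); clear HP HQ.
  note_game X (ax_dia_dual a Q1 P1). note_game X (ax_dia_dual a Q2 P2).
  prop_derive.
Qed.

(** With complementary goals the contradiction premise of M2 is a tautology, so Demon's goal may be
    replaced by any other. *)
Lemma d_dia_weaken X a P Q : derivable X (FImp (dia a P) (FDia a P Q)).
Proof. apply d_M2; prop_derive. Qed.

Lemma d_box_weaken X a P Q : derivable X (FImp (box a Q) (FBox a P Q)).
Proof. apply d_box_M2; prop_derive. Qed.

Lemma d_dia_mono X a P Q :
  derivable X (FImp P Q) -> derivable X (FImp (dia a P) (dia a Q)).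
Proof. intro H; apply d_M2; [exact H | clear H; prop_derive]. Qed.

Lemma d_box_mono X a P Q :
  derivable X (FImp P Q) -> derivable X (FImp (box a P) (box a Q)).
Proof. intro H; apply d_box_M2; [exact H | clear H; prop_derive]. Qed.

Lemma d_dia_congr X a P Q :
  derivable X (FIff P Q) -> derivable X (FIff (dia a P) (dia a Q)).
Proof.
  intro H; apply d_iff; apply d_dia_mono;
    [apply d_iff_l | apply d_iff_r]; exact H.
Qed.

Lemma d_dia_compl X a P Q :
  derivable X (FIff Q (FNot P)) -> derivable X (FIff (FDia a P Q) (dia a P)).
Proof.
  intro H; apply d_iff; apply d_M; prop_derive.
Qed.

Lemma d_box_compl X a P Q :
  derivable X (FIff P (FNot Q)) -> derivable X (FIff (FBox a P Q) (box a Q)).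
Proof.
  intro H; apply d_iff; apply d_box_M; prop_derive.
Qed.

(** In [box a (FNot P)] Angel's goal is literally [FNot (FNot P)]; removing the double negation lets
    det apply to the goal pair of [dia a P]. *)
Lemma d_det_dia X a P :
  derivable X (FIff (FBox a P (FNot P)) (FNot (dia a P))).
Proof.
  assert (derivable X (FIff P (FNot (FNot P)))) as H by prop_derive.
  apply (d_box_compl X a P (FNot P)) in H.
  note_game X (ax_det a P).
  prop_derive.
Qed.

Lemma d_det_box X a Q :
  derivable X (FIff (FDia a (FNot Q) Q) (FNot (box a Q))).
Proof.
  assert (derivable X (FIff Q (FNot (FNot Q)))) as H by prop_derive.
  pose proof (d_dia_compl X a (FNot Q) Q H) as H1.
  assert (derivable X (FImp (box a Q) (box a (FNot (FNot Q))))) as H2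
    by (apply d_box_mono; clear H H1; prop_derive).
  assert (derivable X (FImp (box a (FNot (FNot Q))) (box a Q))) as H3
    by (apply d_box_mono; clear H H1 H2; prop_derive).
  note_game X (ax_det a (FNot Q)).
  clear H; prop_derive.
Qed.

(** * Games with complementary goals *)

(** By det, [FBox b P (FNot P)] is the negation of [dia b P], so the goal pair that the sequence
    axiom hands to [a] is again complementary. *)
Lemma d_dia_seq X a b P :
  derivable X (FIff (dia (GSeq a b) P) (dia a (dia b P))).
Proof.
  pose proof (d_dia_compl X a _ _ (d_det_dia X b P)).
  note_game X (ax_dia_seq a b P (FNot P)).
  prop_derive.
Qed.

Lemma d_box_seq X a b Q :
  derivable X (FIff (box (GSeq a b) Q) (box a (box b Q))).
Proof.
  pose proof (d_box_compl X a _ _ (d_det_box X b Q)).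
  note_game X (ax_box_seq a b (FNot Q) Q).
  prop_derive.
Qed.

(** The disjuncts of the axiom in which both players win the same branch contradict det when the
    goals are complementary. *)
Lemma d_box_choice X a b Q :
  derivable X (FIff (box (GChoice a b) Q) (FAnd (box a Q) (box b Q))).
Proof.
  pose proof (d_det_box X a Q). pose proof (d_det_box X b Q).
  note_game X (ax_box_choice a b (FNot Q) Q).
  prop_derive.
Qed.

Lemma d_dia_star X a P :
  derivable X (FIff (dia (GStar a) P) (FOr P (dia a (dia (GStar a) P)))).
Proof.
  note_game X (ax_dia_star a P (FNot P)).
  pose proof (d_dia_seq X a (GStar a) P).
  prop_derive.
Qed.

Lemma d_box_star X a Q :
  derivable X (FIff (box (GStar a) Q) (FAnd Q (box a (box (GStar a) Q)))).
Proof.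
  note_game X (ax_box_star a (FNot Q) Q).
  pose proof (d_det_box X (GSeq a (GStar a)) Q).
  pose proof (d_box_seq X a (GStar a) Q).
  prop_derive.
Qed.

(** This is FP with [FFalse] as second invariant: if both players won [a] with goals [FFalse], M2
    would give [dia a FFalse] and [box a (FNot FFalse)], against det. *)
Lemma d_dia_star_ind X a P R :
  derivable X (FImp (FOr P (dia a R)) R) ->
  derivable X (FImp (dia (GStar a) P) R).
Proof.
  intro HR.
  assert (derivable X (FImp (FDia a FFalse FFalse) (dia a FFalse))) as H1
    by (apply d_M2; clear HR; prop_derive).
  assert (derivable X (FImp (FBox a FFalse FFalse) (box a (FNot FFalse)))) as H2
    by (apply d_box_M2; clear HR; prop_derive).
  note_game X (ax_det a FFalse).
  assert (derivable X (FImp (FOr (FAnd P (FNot P))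
    (FAnd (FDia a FFalse FFalse) (FBox a FFalse FFalse))) FFalse)) as H3
    by (clear HR; prop_derive).
  pose proof (d_FP X a P (FNot P) R FFalse HR H3).
  clear - H0.
  prop_derive.
Qed.

(** * Differential equations *)

Lemma solution_is_solution o t :
  ~ In t (ode_vars o) -> is_solution o t (solution o t).
Proof.
  intro H; split; [exact H | clear H].
  induction (solution o t); constructor; auto.
Qed.

(** [subst] computes through [FAnd] and [FNot], so substituting the solution instead of assigning it
    makes Boolean reasoning about the goals propositional. *)
Definition ode_reaches (R : formula) s t ys yt (P : formula) : formula :=
  ex_ge0 t (FAnd (stays_in R s t ys) (subst yt P)).

Definition ode_always (R : formula) s t ys yt (Q : formula) : formula :=
  all_ge0 t (FImp (stays_in R s t ys) (subst yt Q)).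

Lemma d_dia_ode_reaches o R s t ys yt P Q :
  is_solution o s ys -> is_solution o t yt -> s <> t ->
  fresh s [R] -> fresh t [R; P; Q] ->
  derivable companion (FIff (FDia (GOde o R) P Q) (ode_reaches R s t ys yt P)).
Proof.
  intros Hs Ht Hst Hf Hf'.
  pose proof (d_ax _ _ (ax_dia_ode_domain o R s t ys yt P Q Hs Ht Hst Hf Hf')).
  assert (derivable companion (FIff
    (ex_ge0 t (FAnd (stays_in R s t ys) (FDia (GAssign yt) P Q)))
    (ode_reaches R s t ys yt P))) as H1.
  { apply d_ex_congr. note_game companion (ax_dia_assign yt P Q). clear H.
    prop_derive. }
  unfold ode_reaches in *.
  prop_derive.
Qed.

Lemma d_box_ode_reaches o R s t ys yt P Q :
  is_solution o s ys -> is_solution o t yt -> s <> t ->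
  fresh s [R] -> fresh t [R; P; Q] ->
  derivable companion (FIff (FBox (GOde o R) P Q)
    (FOr (ode_always R s t ys yt Q) (ode_reaches R s t ys yt (FAnd P Q)))).
Proof.
  intros Hs Ht Hst Hf Hf'.
  pose proof (d_ax _ _ (ax_box_ode_domain o R s t ys yt P Q Hs Ht Hst Hf Hf')).
  assert (derivable companion (FIff
    (all_ge0 t (FImp (stays_in R s t ys) (FBox (GAssign yt) P Q)))
    (ode_always R s t ys yt Q))) as H1.
  { apply d_all_congr. note_game companion (ax_box_assign yt P Q). clear H.
    prop_derive. }
  assert (derivable companion (FIff
    (ex_ge0 t (FAnd (stays_in R s t ys) (FDia (GAssign yt) (FAnd P Q) Q)))
    (ode_reaches R s t ys yt (FAnd P Q)))) as H2.
  { apply d_ex_congr. note_game companion (ax_dia_assign yt (FAnd P Q) Q).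
    clear H H1. prop_derive. }
  unfold ode_reaches, ode_always in *.
  prop_derive.
Qed.

Lemma d_reaches_and_l R s t ys yt P Q :
  derivable companion (FImp (ode_reaches R s t ys yt (FAnd P Q))
                            (ode_reaches R s t ys yt P)).
Proof. apply d_ex_mono. cbn [subst]. prop_derive. Qed.

(** For the goals [FNot Q] and [Q] this removes the cooperative disjunct of the box, which leaves
    [ode_always] alone. *)
Lemma d_reaches_absurd R s t ys yt Q :
  derivable companion (FNot (ode_reaches R s t ys yt (FAnd (FNot Q) Q))).
Proof. apply d_ex_absurd. cbn [subst]. prop_derive. Qed.

(** All times up to which the flow stays in [R] satisfy [Q], in particular the one that witnesses
    [P]. *)
Lemma d_always_reaches R s t ys yt P Q :
  derivable companion (FImp (ode_always R s t ys yt Q)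
    (FImp (ode_reaches R s t ys yt P) (ode_reaches R s t ys yt (FAnd P Q)))).
Proof. apply d_all_ex_mono. cbn [subst]. prop_derive. Qed.

Lemma fresh_exists (l : list var) : exists x, ~ In x l.
Proof.
  exists (S (list_max l)); intro H.
  assert (forall x, In x l -> (x <= list_max l)%nat) as Hmax.
  { apply Forall_forall, list_max_le; lia. }
  specialize (Hmax _ H); lia.
Qed.

Ltac prove_fresh :=
  repeat constructor; cbn [free_vars]; repeat rewrite in_app_iff in *; tauto.

(** [systematize] fixes an ODE, so all three claims concern one game. Diamonds become [ode_reaches]
    of Angel's goal, and boxes become [ode_always] of Demon's goal or [ode_reaches] of the
    conjunction; the three preceding facts on these then suffice propositionally. *)
Lemma ode_compl o R P Q :
  derivable companion (FImp (FAnd (dia (GOde o R) P) (box (GOde o R) Q))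
                            (dia (GOde o R) (FAnd P Q))) /\
  derivable companion (FIff (FDia (GOde o R) P Q)
    (FOr (dia (GOde o R) (FAnd P Q)) (dia (GOde o R) P))) /\
  derivable companion (FIff (FBox (GOde o R) P Q)
    (FOr (dia (GOde o R) (FAnd P Q)) (box (GOde o R) Q))).
Proof.
  set (l := ode_vars o ++ free_vars R ++ free_vars P ++ free_vars Q).
  destruct (fresh_exists l) as [s Hs].
  destruct (fresh_exists (s :: l)) as [t Ht].
  assert (s <> t) as Hst by (intro; apply Ht; left; assumption).
  assert (~ In t l) as Ht' by (intro; apply Ht; right; assumption).
  subst l; repeat rewrite in_app_iff in *; clear Ht.
  assert (is_solution o s (solution o s)) as Ss
    by (apply solution_is_solution; tauto).
  assert (is_solution o t (solution o t)) as St
    by (apply solution_is_solution; tauto).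
  assert (fresh s [R]) as Fs by prove_fresh.
  set (ys := solution o s) in *; set (yt := solution o t) in *.
  pose proof (fun P' Q' => d_dia_ode_reaches o R s t ys yt P' Q' Ss St Hst Fs) as D.
  pose proof (fun P' Q' => d_box_ode_reaches o R s t ys yt P' Q' Ss St Hst Fs) as B.
  assert (fresh t [R; P; Q]) as F1 by prove_fresh.
  assert (fresh t [R; P; FNot P]) as F2 by prove_fresh.
  assert (fresh t [R; FNot Q; Q]) as F3 by prove_fresh.
  assert (fresh t [R; FAnd P Q; FNot (FAnd P Q)]) as F4 by prove_fresh.
  pose proof (D _ _ F1); pose proof (D _ _ F2); pose proof (D _ _ F4).
  pose proof (B _ _ F1); pose proof (B _ _ F3).
  pose proof (d_reaches_and_l R s t ys yt P Q).
  pose proof (d_reaches_absurd R s t ys yt Q).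
  pose proof (d_always_reaches R s t ys yt P Q).
  clear D B.
  unfold dia, box.
  generalize dependent (ode_reaches R s t ys yt); intro N; intros.
  generalize dependent (ode_always R s t ys yt); intro A; intros.
  repeat split; prop_derive.
Qed.

(** * Complementarization *)

Lemma dia_box_interaction a : forall P Q,
  derivable companion
    (FImp (FAnd (dia a P) (box a Q)) (dia (systematize a) (FAnd P Q))).
Proof.
  induction a as [r | o R | R | a IHa b IHb | a IHa b IHb | a IHa | a IHa];
    intros P Q; cbn [systematize].
  - note_game companion (ax_dia_assign r P (FNot P)).
    note_game companion (ax_box_assign r (FNot Q) Q).
    note_game companion (ax_dia_assign r (FAnd P Q) (FNot (FAnd P Q))).
    cbn [subst] in *. prop_derive.
  - apply ode_compl.
  - note_game companion (ax_dia_test R P (FNot P)).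
    note_game companion (ax_box_test R (FNot Q) Q).
    note_game companion (ax_dia_test R (FAnd P Q) (FNot (FAnd P Q))).
    prop_derive.
  - specialize (IHa P Q). specialize (IHb P Q).
    note_game companion (ax_dia_choice a b P (FNot P)).
    pose proof (d_box_choice companion a b Q).
    note_game companion (ax_dia_choice (systematize a) (systematize b)
      (FAnd P Q) (FNot (FAnd P Q))).
    prop_derive.
  - specialize (IHa (dia b P) (box b Q)).
    pose proof (d_dia_mono companion (systematize a) _ _ (IHb P Q)).
    clear IHb.
    pose proof (d_dia_seq companion a b P).
    pose proof (d_box_seq companion a b Q).
    pose proof (d_dia_seq companion (systematize a) (systematize b) (FAnd P Q)).
    prop_derive.
  (* Dualizing exchanges the players, so the hypothesis is taken at swapped goals. *)
  - specialize (IHa Q P).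
    note_game companion (ax_dia_dual a P (FNot P)).
    pose proof (d_ax _ _ (ax_box_dual a (FNot Q) Q)).
    assert (derivable companion (FImp (dia (systematize a) (FAnd Q P))
      (dia (systematize a) (FAnd P Q)))) by (apply d_dia_mono; prop_derive).
    prop_derive.
  (* Loop induction has only [dia (GStar a) P] as antecedent; Demon's strategy is therefore moved
     into the invariant as a hypothesis. *)
  - set (R := FImp (box (GStar a) Q) (dia (GStar (systematize a)) (FAnd P Q))).
    assert (derivable companion (FImp (dia (GStar a) P) R)) as H.
    { apply d_dia_star_ind.
      (* Unfolding [box (GStar a) Q] supplies Demon's goal after one round, where it discharges the
         hypothesis of [R]. *)
      specialize (IHa R (box (GStar a) Q)).
      assert (derivable companion
        (FImp (FAnd R (box (GStar a) Q))
              (dia (GStar (systematize a)) (FAnd P Q)))) as H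
        by (clear IHa; subst R; prop_derive).
      apply (d_dia_mono companion (systematize a)) in H.
      pose proof (d_box_star companion a Q).
      pose proof (d_dia_star companion (systematize a) (FAnd P Q)).
      subst R; prop_derive. }
    clear IHa; subst R; prop_derive.
Qed.

(** If Angel cannot win [Q], det gives Demon a strategy for [FNot Q]; played against Angel's
    strategy for the disjunction, it ends in [P]. *)
Lemma d_dia_split a P Q :
  derivable companion
    (FImp (dia a (FOr P Q)) (FOr (dia (systematize a) P) (dia a Q))).
Proof.
  pose proof (dia_box_interaction a (FOr P Q) (FNot Q)).
  assert (derivable companion (FImp
    (dia (systematize a) (FAnd (FOr P Q) (FNot Q)))
    (dia (systematize a) P))) by (apply d_dia_mono; clear; prop_derive).
  note_game companion (ax_det a Q).
  prop_derive.
Qed.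

Lemma d_box_split a P Q :
  derivable companion
    (FImp (box a (FOr P Q)) (FOr (dia (systematize a) P) (box a Q))).
Proof.
  pose proof (dia_box_interaction a (FNot Q) (FOr P Q)).
  assert (derivable companion (FImp
    (dia (systematize a) (FAnd (FNot Q) (FOr P Q)))
    (dia (systematize a) P))) by (apply d_dia_mono; clear; prop_derive).
  pose proof (d_det_box companion a Q).
  assert (derivable companion (FImp (FDia a (FNot Q) Q) (dia a (FNot Q))))
    by (apply d_M; clear; prop_derive).
  prop_derive.
Qed.

(** * The two equivalences, by induction on the game *)

Definition dia_compl a P Q : formula :=
  FIff (FDia a P Q) (FOr (dia (systematize a) (FAnd P Q)) (dia a P)).

Definition box_compl a P Q : formula :=
  FIff (FBox a P Q) (FOr (dia (systematize a) (FAnd P Q)) (box a Q)).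

(** If both players win, either one of them relies on a cooperative play, or each wins alone and the
    interaction principle produces such a play. *)
Lemma dia_box_systematize a P Q :
  derivable companion (dia_compl a P Q) ->
  derivable companion (box_compl a P Q) ->
  derivable companion (FIff (FAnd (FDia a P Q) (FBox a P Q))
                            (dia (systematize a) (FAnd P Q))).
Proof.
  intros H1 H2; unfold dia_compl, box_compl in *.
  pose proof (dia_box_interaction a P Q).
  prop_derive.
Qed.

Lemma seq_compl a b P Q :
  (forall P Q, derivable companion (dia_compl a P Q) /\
               derivable companion (box_compl a P Q)) ->
  derivable companion (dia_compl b P Q) ->
  derivable companion (box_compl b P Q) ->
  derivable companion (dia_compl (GSeq a b) P Q) /\
  derivable companion (box_compl (GSeq a b) P Q).
Proof.
  intros IHa D B.
  destruct (IHa (FDia b P Q) (FBox b P Q)) as [Da Ba]; clear IHa.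
  (* The cooperative outcome for [a] is that both players win [b], which amounts to a cooperative
     play of [b]. *)
  pose proof (d_dia_congr companion (systematize a) _ _
                (dia_box_systematize b P Q D B)).
  pose proof (d_dia_seq companion (systematize a) (systematize b) (FAnd P Q)).
  set (S := dia (systematize b) (FAnd P Q)) in *.
  unfold dia_compl, box_compl in *; cbn [systematize].
  split.
  - clear Ba B.
    apply d_iff_l, (d_dia_mono companion a) in D.
    (* Angel's goal for [a] is now a disjunction: the part [S] is passed to [systematize a], the
       part [dia b P] stays with [a]. *)
    pose proof (d_dia_split a S (dia b P)).
    pose proof (d_dia_seq companion a b P).
    pose proof (d_dia_weaken companion (GSeq a b) P Q).
    note_game companion (ax_dia_seq a b P Q).
    subst S; prop_derive.
  - clear Da D.
    apply d_iff_l, (d_box_mono companion a) in B.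
    pose proof (d_box_split a S (box b Q)).
    pose proof (d_box_seq companion a b Q).
    pose proof (d_box_weaken companion (GSeq a b) P Q).
    note_game companion (ax_box_seq a b P Q).
    subst S; prop_derive.
Qed.

Lemma star_compl a P Q :
  (forall P Q, derivable companion (dia_compl a P Q) /\
               derivable companion (box_compl a P Q)) ->
  derivable companion (dia_compl (GStar a) P Q) /\
  derivable companion (box_compl (GStar a) P Q).
Proof.
  intro IHa.
  pose proof (fun P Q => dia_box_systematize a P Q (proj1 (IHa P Q)) (proj2 (IHa P Q)))
    as IH; clear IHa; cbn beta in IH.
  set (S := dia (GStar (systematize a)) (FAnd P Q)).
  pose proof (d_dia_star companion (systematize a) (FAnd P Q)) as HS.
  (* Both players winning [a] with goal [S] means that [systematize a] can reach [S], and one more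
     round is absorbed by the star. *)
  assert (derivable companion
    (FImp (FOr (FAnd P Q) (FAnd (FDia a S S) (FBox a S S))) S)) as HR2.
  { specialize (IH S S).
    assert (derivable companion (FImp (dia (systematize a) (FAnd S S))
      (dia (systematize a) S))) by (apply d_dia_mono; clear; prop_derive).
    subst S; prop_derive. }
  assert (derivable companion (FImp (FDia (GStar a) P Q) (FOr (dia (GStar a) P) S)))
    as H1.
  (* The first invariant is [dia (GStar a) P] itself, closed under its own unfolding. *)
  { apply d_FP; [apply d_iff_r, d_dia_star | exact HR2]. }
  assert (derivable companion (FImp (FBox (GStar a) P Q) (FOr (box (GStar a) Q) S)))
    as H2.
  { eapply d_ext; [apply ru_FP_box |].
    intros G [<- | []]; exact HR2. }
  assert (derivable companion
    (FImp S (FAnd (FDia (GStar a) P Q) (FBox (GStar a) P Q)))) as H3.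
  { apply d_dia_star_ind.
    (* A cooperative round into this invariant means that both players win [a] with the loop's
       diamond and box as goals. By the sequence axioms both then win [GSeq a (GStar a)], and the
       star axioms fold this back. *)
    specialize (IH (FDia (GStar a) P Q) (FBox (GStar a) P Q)).
    note_game companion (ax_dia_seq a (GStar a) P Q).
    note_game companion (ax_box_seq a (GStar a) P Q).
    note_game companion (ax_dia_star a P Q).
    note_game companion (ax_box_star a P Q).
    clear HS HR2 H1 H2; prop_derive. }
  pose proof (d_dia_weaken companion (GStar a) P Q).
  pose proof (d_box_weaken companion (GStar a) P Q).
  clear HS HR2.
  unfold dia_compl, box_compl; cbn [systematize]; fold S.
  split; prop_derive.
Qed.

Lemma complementarization_derivable a : forall P Q,
  derivable companion (dia_compl a P Q) /\
  derivable companion (box_compl a P Q).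
Proof.
  induction a as [r | o R | R | a IHa b IHb | a IHa b IHb | a IHa | a IHa];
    intros P Q.
  - note_game companion (ax_dia_assign r P Q).
    note_game companion (ax_box_assign r P Q).
    note_game companion (ax_dia_assign r P (FNot P)).
    note_game companion (ax_box_assign r (FNot Q) Q).
    note_game companion (ax_dia_assign r (FAnd P Q) (FNot (FAnd P Q))).
    cbn [subst] in *; unfold dia_compl, box_compl.
    split; prop_derive.
  - apply ode_compl.
  - note_game companion (ax_dia_test R P Q).
    note_game companion (ax_box_test R P Q).
    note_game companion (ax_dia_test R P (FNot P)).
    note_game companion (ax_box_test R (FNot Q) Q).
    note_game companion (ax_dia_test R (FAnd P Q) (FNot (FAnd P Q))).
    unfold dia_compl, box_compl.
    split; prop_derive.
  - destruct (IHa P Q) as [Da Ba], (IHb P Q) as [Db Bb]; clear IHa IHb.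
    note_game companion (ax_dia_choice (systematize a) (systematize b)
      (FAnd P Q) (FNot (FAnd P Q))).
    unfold dia_compl, box_compl in *; split.
    + clear Ba Bb.
      note_game companion (ax_dia_choice a b P Q).
      note_game companion (ax_dia_choice a b P (FNot P)).
      prop_derive.
    (* In the disjuncts where both players win the same branch, interaction yields a cooperative
       play of that branch. *)
    + pose proof (dia_box_interaction a P Q).
      pose proof (dia_box_interaction b P Q).
      note_game companion (ax_box_choice a b P Q).
      pose proof (d_box_choice companion a b Q).
      prop_derive.
  - apply seq_compl; [exact IHa | apply IHb | apply IHb].
  - destruct (IHa Q P); clear IHa.
    note_game companion (ax_dia_dual a P Q).
    note_game companion (ax_dia_dual a P (FNot P)).
    pose proof (d_ax _ _ (ax_box_dual a P Q)).
    pose proof (d_ax _ _ (ax_box_dual a (FNot Q) Q)).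
    assert (derivable companion (FIff (dia (systematize a) (FAnd Q P))
      (dia (systematize a) (FAnd P Q))))
      by (apply d_dia_congr; clear; prop_derive).
    unfold dia_compl, box_compl in *.
    split; prop_derive.
  - apply star_compl, IHa.
Qed.

(** * Admissibility *)

Theorem theorem2 (F : formula) :
  derivable (adjoin companion complementarization) F <-> derivable companion F.
Proof.
  split; intro H.
  (* Each use of an added axiom is replaced by its derivation; all other rules carry over. *)
  - induction H; eauto using derivable.
    destruct H as [H | H].
    + eapply d_ext; eassumption.
    + destruct H; apply complementarization_derivable.
  - induction H; eauto using derivable.
    eapply d_ext; [left; eassumption | assumption].
Qed.
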